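(* Let $\Sigma=\{a,b\}$. There are absolute constants (independent of the grammar) such that for every commutative grammar $G=(\Sigma,S,s_0,\delta)$ over $\Sigma$ we have $\mathrm{out}(G)=\bigcup_{i\in I}Z_i$, where $|I|=|S|^{O(1)}$ and each $Z_i$ is an $A,B$-frame with $A,B=O\!\left(2^{|S|^{O(1)}}\right)$.
   Context: For a finite set $X$, $[0..K]$ denotes $\{0,1,\ldots,K\}$, and $F^X_X$ denotes matrices with entries in $F$ indexed by $X\times X$, with columns $M^x\in F^X$; for $v\in\mathbb{N}^X$, $Mv=\sum_x v_x M^x$, and $M\mathbb{N}^X=\{Mv:v\in\mathbb{N}^X\}$. An $A,B$-frame is a set of the form $W+M\mathbb{N}^\Sigma=\{w+Mv: w\in W, v\in\mathbb{N}^\Sigma\}$ with $W\subseteq[0..A]^\Sigma$ and $M\in[0..B]^\Sigma_\Sigma$. A commutative grammar is $G=(\Sigma,S,s_0,\delta)$ with finite alphabet $\Sigma$, finite state set $S$, $s_0\in S$, and a finite set $\delta\subseteq S\times\mathbb{N}^\Sigma\times\mathbb{N}^S$ of transitions $\tau=(s,a,t)$ ($\mathrm{source}(\tau)=s$, $\mathrm{out}(\tau)=a$, $\mathrm{target}(\tau)=t$); every state is the source of some transition, and every transition has $|a|\le1$, $|t|\le2$ (where $|v|=\sum_x v(x)$). For $D\in\mathbb{N}^\delta$ let $\mathrm{source}(D)(s)=\sum_{\mathrm{source}(\tau)=s}D(\tau)$, $\mathrm{out}(D)=\sum_\tau D(\tau)\mathrm{out}(\tau)$, $\mathrm{target}(D)=\sum_\tau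 D(\tau)\mathrm{target}(\tau)$, $\mathrm{supp}(D)=\{s:\mathrm{source}(D)(s)>0\}$. $D$ is a run if $\mathrm{source}(D)=\mathrm{target}(D)+\{s_0\}$ and every $t\in\mathrm{supp}(D)$ equals $s_0$ or is reachable by transitions $\tau_1,\ldots,\tau_m$ with $D(\tau_i)>0$, $\mathrm{source}(\tau_1)=s_0$, $\mathrm{source}(\tau_{i+1})\in\mathrm{target}(\tau_i)$, $t\in\mathrm{target}(\tau_m)$. $\mathrm{out}(G)=\{\mathrm{out}(D):D\text{ a run}\}$ (the Parikh image of the corresponding context-free grammar). *)

(* Defs.v *)
From mathcomp Require Import all_boot.
Set Implicit Arguments. Unset Strict Implicit. Unset Printing Implicit Defensive.

(* Alphabet Sigma = {a,b} is represented by bool; vectors in N^Sigma. *)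
Definition vec := {ffun bool -> nat}.

Definition vadd (u v : vec) : vec := [ffun x => u x + v x].

Definition vsize (T : finType) (v : {ffun T -> nat}) : nat := \sum_(x : T) v x.

Definition mvmul (M : bool -> bool -> nat) (v : vec) : vec :=
  [ffun y => \sum_(x : bool) v x * M y x].

Definition is_frame (A B : nat) (Z : vec -> Prop) : Prop :=
  exists (W : vec -> Prop) (M : bool -> bool -> nat),
    (forall w, W w -> forall x, w x <= A) /\
    (forall x y, M x y <= B) /\
    (forall u, Z u <-> exists w v, W w /\ u = vadd w (mvmul M v)).

Definition trans (S : finType) : Type := (S * vec * {ffun S -> nat})%type.
Definition source (S : finType) (tau : trans S) : S := tau.1.1.
Definition tout (S : finType) (tau : trans S) : vec := tau.1.2.
Definition target (S : finType) (tau : trans S) : {ffun S -> nat} := tau.2.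

Record cgrammar (S : finType) := CGrammar {
  s0 : S;
  delta : seq (trans S);
  delta_uniq : uniq delta;
  delta_cover : forall s : S, exists2 tau, tau \in delta & source tau = s;
  delta_out : forall tau, tau \in delta -> vsize (tout tau) <= 1;
  delta_target : forall tau, tau \in delta -> vsize (target tau) <= 2
}.

Section Runs.
Variables (S : finType) (G : cgrammar S).

(* D in N^delta, represented as a function on transitions (only values on
   delta matter). *)
Definition src_of (D : trans S -> nat) (s : S) : nat :=
  \sum_(tau <- delta G | source tau == s) D tau.
Definition out_of (D : trans S -> nat) : vec :=
  [ffun x => \sum_(tau <- delta G) D tau * tout tau x].
Definition tgt_of (D : trans S -> nat) (s : S) : nat :=
  \sum_(tau <- delta G) D tau * target tau s.

Definition is_run (D : trans S -> nat) : Prop :=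
  (forall s, src_of D s = tgt_of D s + (s == s0 G)) /\
  (forall t, 0 < src_of D t ->
     t = s0 G \/
     exists (tau1 : trans S) (rest : seq (trans S)),
       all (fun tau => (tau \in delta G) && (0 < D tau)) (tau1 :: rest) /\
       source tau1 = s0 G /\
       path (fun tau tau' => 0 < target tau (source tau')) tau1 rest /\
       0 < target (last tau1 rest) t).

Definition out_lang (u : vec) : Prop := exists D, is_run D /\ u = out_of D.
End Runs.

(* Main.v *)
Require Import Defs.
From mathcomp Require Import all_boot zify.
From Stdlib Require Import Classical.

(* Runs are the vectors of firing sequences leading from [s0] to the empty
   multiset in the Petri net whose places are the states (an Eulerian-path
   argument), and these correspond to derivation trees.  A loop at a state s,
   i.e. a firing sequence from [s] to [s], can be added to any run visiting s,
   whatever the rest of its support is; conversely every run with large output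
   is a small run with the same support plus small loops.  Let f s and g s be
   the outputs of small loops at s of greatest and least slope.  For a run with
   support X choose s and t in X such that f s has greatest and g t least slope:
   the outputs of all removed loops lie in the cone of f s and g t, so a bounded
   multiple of each is a combination of these two, and all but boundedly many of
   them can be traded for copies of f s and g t.  Hence the frames can be indexed
   by the pairs (s, t), not by the exponentially many supports. *)

Set Implicit Arguments. Unset Strict Implicit. Unset Printing Implicit Defensive.

(** * Firing sequences on multisets of states *)

Section Firing.
Variables (S : finType) (G : cgrammar S).
Implicit Types (m q r : seq S) (L K P T R : seq (trans S)) (s t x y z : S).

Definition kids (tau : trans S) : seq S :=
  flatten [seq nseq (target tau s) s | s <- enum S].

Lemma count_kids tau s : count_mem s (kids tau) = target tau s.
Proof.
rewrite count_flatten -map_comp sumnE big_map (bigD1_seq s) ?mem_enum ?enum_uniq //=.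
rewrite count_nseq /= eqxx mul1n big1 ?addn0 // => t ts.
by rewrite count_nseq /= (negPf ts).
Qed.

Lemma mem_kids tau s : (s \in kids tau) = (0 < target tau s).
Proof. by rewrite -has_pred1 has_count count_kids. Qed.

Lemma size_kids tau : size (kids tau) = vsize (target tau).
Proof.
rewrite size_flatten /shape -map_comp sumnE big_map /vsize big_enum /=.
by apply: eq_bigr => s _; rewrite size_nseq.
Qed.

(** Multisets are sequences up to [perm_eq]. The remainder [r] is what stays in the marking when one
    token [source tau] is replaced by [kids tau]. *)
Fixpoint fires m L m' : Prop :=
  if L is tau :: L' then
    tau \in delta G /\
    exists2 r, perm_eq m (source tau :: r) & fires (kids tau ++ r) L' m'
  else perm_eq m m'.

Lemma fires_perm m1 m2 L m : perm_eq m1 m2 -> fires m1 L m -> fires m2 L m.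
Proof.
case: L => [|tau L] /= e12; first by rewrite (permPl e12).
by case=> ? [r e ?]; split=> //; exists r => //; rewrite -(permPl e12).
Qed.

Lemma fires_frame m L m' q : fires m L m' -> fires (m ++ q) L (m' ++ q).
Proof.
elim: L m => [|tau L IH] m /=; first by rewrite perm_cat2r.
case=> ? [r e f]; split=> //; exists (r ++ q); first by rewrite -cat_cons perm_cat2r.
by rewrite catA; apply: IH.
Qed.

Lemma fires_cat m L1 m' L2 m'' :
  fires m L1 m' -> fires m' L2 m'' -> fires m (L1 ++ L2) m''.
Proof.
elim: L1 m => [|tau L IH] m /=; first by move=> e; apply: fires_perm; rewrite perm_sym.
by case=> ? [r e f] f2; split=> //; exists r => //; apply: IH.
Qed.

Lemma fires_catP m L1 L2 m'' :
  fires m (L1 ++ L2) m'' -> exists2 m', fires m L1 m' & fires m' L2 m''.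
Proof.
elim: L1 m => [|tau L IH] m /=; first by exists m.
case=> ? [r e f]; have [m' f1 f2] := IH _ f.
by exists m' => //; split=> //; exists r.
Qed.

Lemma fires_delta m L m' : fires m L m' -> {subset L <= delta G}.
Proof.
elim: L m => [|tau L IH] m //= [td [r _ /IH f]] t.
by rewrite inE => /predU1P [->|/f].
Qed.

(** A transition consumes exactly one token, so each firing can be charged to the half of the
    marking from which its token descends. *)
Lemma fires_split m1 m2 L : fires (m1 ++ m2) L [::] ->
  exists L1 L2, [/\ perm_eq L (L1 ++ L2), fires m1 L1 [::] & fires m2 L2 [::]].
Proof.
elim: L m1 m2 => [|tau L IH] m1 m2 /=.
  move/perm_nilP/eqP; rewrite -size_eq0 size_cat addn_eq0 => /andP[/nilP-> /nilP->].
  by exists [::], [::].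
case=> td [r e f].
have: source tau \in m1 ++ m2 by rewrite (perm_mem e) mem_head.
rewrite mem_cat => /orP[] /perm_to_rem em.
- have/IH[L1 [L2 [eL f1 f2]]] : fires ((kids tau ++ rem (source tau) m1) ++ m2) L [::].
    apply: fires_perm f; rewrite -catA perm_cat2l -(perm_cons (source tau)) -(permPl e).
    by rewrite -cat_cons perm_cat2r.
  exists (tau :: L1), L2; split=> //; first by rewrite perm_cons.
  by split=> //; exists (rem (source tau) m1).
- have/IH[L1 [L2 [eL f1 f2]]] : fires (m1 ++ (kids tau ++ rem (source tau) m2)) L [::].
    apply: fires_perm f; rewrite perm_sym perm_catCA perm_cat2l.
    rewrite -(perm_cons (source tau)) perm_sym -(permPl e).
    by rewrite -cat1s perm_sym perm_catCA perm_cat2l perm_sym.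
  exists L1, (tau :: L2); split=> //.
    by rewrite -[tau :: L2]cat1s perm_sym perm_catCA perm_cons perm_sym.
  by split=> //; exists (rem (source tau) m2).
Qed.

Definition nsrc L s := \sum_(tau <- L) (source tau == s).
Definition ntgt L s := \sum_(tau <- L) target tau s.
Definition outL L (c : bool) := \sum_(tau <- L) tout tau c.
Definition weight L := \sum_(tau <- L) vsize (tout tau).
Definition supp L : {set S} := [set s | s \in map (@source S) L].

Lemma nsrc_perm L1 L2 s : perm_eq L1 L2 -> nsrc L1 s = nsrc L2 s.
Proof. exact: perm_big. Qed.

Lemma ntgt_perm L1 L2 s : perm_eq L1 L2 -> ntgt L1 s = ntgt L2 s.
Proof. exact: perm_big. Qed.

Lemma nsrc_cons tau L s : nsrc (tau :: L) s = (source tau == s) + nsrc L s.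
Proof. exact: big_cons. Qed.

Lemma ntgt_cons tau L s : ntgt (tau :: L) s = target tau s + ntgt L s.
Proof. exact: big_cons. Qed.

Lemma nsrc_cat L1 L2 s : nsrc (L1 ++ L2) s = nsrc L1 s + nsrc L2 s.
Proof. exact: big_cat. Qed.

Lemma ntgt_cat L1 L2 s : ntgt (L1 ++ L2) s = ntgt L1 s + ntgt L2 s.
Proof. exact: big_cat. Qed.

Lemma perm_extract tau R : tau \in R -> exists R1 : seq (trans S), perm_eq R (tau :: R1).
Proof. by move=> /perm_to_rem; exists (rem tau R). Qed.

Lemma nsrc_gt0 L s : (0 < nsrc L s) = (s \in supp L).
Proof.
rewrite inE /nsrc; elim: L => [|tau L IH]; first by rewrite big_nil.
by rewrite big_cons /= inE -IH eq_sym; case: eqP.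
Qed.

Lemma supp_perm L1 L2 : perm_eq L1 L2 -> supp L1 = supp L2.
Proof. by move=> e; apply/setP=> s; rewrite !inE (perm_mem (perm_map _ e)). Qed.

Lemma supp_cat L1 L2 : supp (L1 ++ L2) = supp L1 :|: supp L2.
Proof. by apply/setP=> s; rewrite !inE map_cat mem_cat. Qed.

Lemma weightE L : weight L = outL L true + outL L false.
Proof.
by rewrite /weight /outL -big_split; apply: eq_bigr => tau _; rewrite /vsize big_bool.
Qed.

Lemma fires_balance m L m' s : fires m L m' ->
  nsrc L s + count_mem s m' = ntgt L s + count_mem s m.
Proof.
rewrite /nsrc /ntgt.
elim: L m => [|tau L IH] m /=; first by rewrite !big_nil => /permP ->.
case=> _ [r /permP e /IH]; rewrite !big_cons e /= count_cat count_kids; lia.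
Qed.

(** Just before [L] fires a transition with source [s], a token [s] is present; firing [P] at that
    moment restores the marking. *)
Lemma fires_insert s P m L m' :
  fires [:: s] P [:: s] -> fires m L m' -> s \in supp L ->
  exists2 L', fires m L' m' & perm_eq L' (P ++ L).
Proof.
move=> fP fL; rewrite inE => /mapP[tau tauL se].
case/path.splitPr: L / tauL fL => L1 L2 /fires_catP[m1 f1 /= [td [r e f2]]].
exists (L1 ++ P ++ tau :: L2); last by rewrite perm_catCA.
apply: (fires_cat f1); apply: (fires_cat (m' := s :: r)).
  apply: fires_perm (fires_frame r fP); by rewrite perm_sym se.
by split=> //; exists r; rewrite ?se.
Qed.

(** * Ordering a run into a firing sequence *)

Lemma greedy n m R : size R <= n -> {subset R <= delta G} ->
  (forall s, nsrc R s = ntgt R s + count_mem s m) ->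
  exists L R', perm_eq R (L ++ R') /\ fires m L [::].
Proof.
elim: n m R => [|n IH] [|s m] R sR Rd bal; try by exists [::], R.
  by move: (bal s); case: R sR {Rd bal} => // _; rewrite /nsrc big_nil /= eqxx; lia.
have: 0 < nsrc R s by rewrite bal /= eqxx; lia.
rewrite nsrc_gt0 inE => /mapP[tau tauR se].
have [R1 eR] := perm_extract tauR.
have [||s'|L [R' [eL fL]]] := IH (kids tau ++ m) R1.
- by move: sR; rewrite (perm_size eR).
- by move=> t tR; apply: Rd; rewrite (perm_mem eR) inE tR orbT.
- have := bal s'; rewrite (nsrc_perm _ eR) (ntgt_perm _ eR).
  by rewrite nsrc_cons ntgt_cons count_cat count_kids /= se; lia.
exists (tau :: L), R'; split; first by rewrite (permPl eR) perm_cons.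
by split; [apply: Rd | exists m; rewrite ?se].
Qed.

Definition edge R x z := has (fun tau => (source tau == x) && (0 < target tau z)) R.

(** Along a simple path the sources are distinct, so each edge can be realized by an occurrence of
    its own in [R]. The tokens produced off the path accumulate in [q]. *)
Lemma path_fires R x p : {subset R <= delta G} -> path (edge R) x p -> uniq (x :: p) ->
  exists L R' q, perm_eq R (L ++ R') /\ fires [:: x] L (last x p :: q).
Proof.
elim: p x R => [|z p IH] x R Rd; first by move=> _ _; exists [::], R, [::]; split=> /=.
rewrite [path _ _ _]/= cons_uniq.
case/andP=> /hasP[tau tauR /andP[/eqP se tz]] pz /andP[xp uq].
have [R1 eR] := perm_extract tauR.
have [||L [R' [q [eL fL]]]] := IH z R1 _ _ uq.
- by move=> t tR; apply: Rd; rewrite (perm_mem eR) inE tR orbT.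
- apply: (sub_in_path (P := fun y => y != x)) pz; last first.
    by apply/allP=> y yp; apply: contraNneq xp => <-.
  move=> y1 y2; rewrite !unfold_in => n1 _; rewrite /edge (perm_has _ eR) /= se.
  by rewrite eq_sym (negPf n1).
have /perm_to_rem ez : z \in kids tau by rewrite mem_kids.
exists (tau :: L), R', (q ++ rem z (kids tau)); split.
  by rewrite (permPl eR) perm_cons.
split; first exact: Rd.
exists [::]; rewrite ?se //; rewrite cats0.
by apply: fires_perm (fires_frame (rem z (kids tau)) fL); rewrite perm_sym.
Qed.

(** Fire once around a cycle back to [y], then discharge the tokens produced on the side while the
    token [y] waits. *)
Lemma cycle_fires R y z : {subset R <= delta G} ->
  (forall s, nsrc R s = ntgt R s) -> edge R y z -> connect (edge R) z y ->
  exists P R', [/\ perm_eq R (P ++ R'), P != [::] & fires [:: y] P [:: y]].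
Proof.
move=> Rd bal /hasP[tau tauR /andP[/eqP se tz]] /connectP[p0 pp0].
case/shortenP: pp0 => p pz uq _ ey.
have [R1 eR] := perm_extract tauR.
have R1d : {subset R1 <= delta G}.
  by move=> t tR; apply: Rd; rewrite (perm_mem eR) inE tR orbT.
have pz1 : path (edge R1) z p.
  have: y \notin belast z p by move: uq; rewrite lastI -ey rcons_uniq => /andP[].
  elim: (p) (z) pz => //= z' p' IH z1 /andP[h /IH {}IH]; rewrite inE negb_or.
  case/andP=> yz1 /IH ->; rewrite andbT; move: h.
  by rewrite /edge (perm_has _ eR) /= se (negPf yz1).
have [L [R2 [q [eL fL]]]] := path_fires R1d pz1 uq.
have /perm_to_rem ez : z \in kids tau by rewrite mem_kids.
rewrite -ey in fL.
set q' := q ++ rem z (kids tau).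
have f1 : fires [:: y] (tau :: L) (y :: q').
  split; first exact: Rd.
  exists [::]; rewrite ?se //; rewrite cats0.
  by apply: fires_perm (fires_frame (rem z (kids tau)) fL); rewrite perm_sym.
have eR2 : perm_eq R ((tau :: L) ++ R2) by rewrite (permPl eR) perm_cons.
(* Subtracting the balance of the fired cycle from that of [R] leaves [R2] balanced against the
   by-products [q']. *)
have [||s|L2 [R3 [eR3 f2]]] := @greedy (size R2) q' R2.
- by [].
- by move=> t tR; apply: Rd; rewrite (perm_mem eR2) mem_cat tR orbT.
- have := bal s; have := fires_balance s f1.
  rewrite (nsrc_perm _ eR2) (ntgt_perm _ eR2) nsrc_cat ntgt_cat /=.
  lia.
exists ((tau :: L) ++ L2), R3; split=> //.
  by rewrite (permPl eR2) -catA perm_cat2l.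
apply: (fires_cat f1).
by have := fires_frame [:: y] f2; apply: fires_perm; rewrite cats1 perm_rcons.
Qed.

End Firing.

(** Take [y] in [A] with the fewest predecessors. A predecessor [x] of [y] in [A] that is not its
    own predecessor would have strictly fewer. *)
Lemma transitive_has_loop (T : finType) (r : rel T) (A : {set T}) a :
  transitive r -> a \in A -> (forall y, y \in A -> exists2 x, x \in A & r x y) ->
  exists2 y, y \in A & r y y.
Proof.
move=> rt aA pred; case: (pickP [pred y in A | r y y]) => [y /andP[]|noloop].
  by exists y.
case: (arg_minnP (P := mem A) (fun y => #|[set z | r z y]|) aA) => y yA ymin.
have [x xA rxy] := pred _ yA.
have /ymin : x \in A by [].
rewrite leqNgt => /negP[]; apply/proper_card/properP; split.
  by apply/subsetP=> z; rewrite !inE => /rt; apply.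
by exists x; rewrite !inE //; have := noloop x; rewrite /= xA /= => ->.
Qed.

Section Ordering.
Variables (S : finType) (G : cgrammar S).
Implicit Types (m q r : seq S) (L K P T R : seq (trans S)) (s t x y z : S).

(** The connectivity condition of [is_run] in inductive form, for a sequence of transitions instead
    of a vector of counts. *)
Inductive reached L : S -> Prop :=
| reached_start : reached L (s0 G)
| reached_step tau z : reached L (source tau) -> tau \in L -> 0 < target tau z -> reached L z.

Lemma ntgt_gt0 L s : 0 < ntgt L s -> exists2 tau, tau \in L & 0 < target tau s.
Proof.
rewrite /ntgt lt0n sum_nat_seq_neq0 => /hasP[tau tauL] /=.
by rewrite -lt0n; exists tau.
Qed.

Lemma ntgt_ge L tau s : tau \in L -> target tau s <= ntgt L s.
Proof. by move=> tauL; rewrite /ntgt (perm_big _ (perm_to_rem tauL)) big_cons leq_addr. Qed.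

(** The Eulerian step: the balanced leftover [R] contains a cycle through a state that [T] visits,
    and the loop it yields is moved from [R] into [T]. *)
Lemma splice_cycle T R : {subset R <= delta G} -> fires G [:: s0 G] T [::] -> R != [::] ->
  (forall s, nsrc R s = ntgt R s) -> (forall s, s \in supp R -> reached (T ++ R) s) ->
  exists T' R', [/\ fires G [:: s0 G] T' [::], perm_eq (T ++ R) (T' ++ R') & size R' < size R].
Proof.
move=> Rd fT Rn0 bal reach.
have balT s : nsrc T s = ntgt T s + (s == s0 G).
  by have := fires_balance s fT; rewrite /= addn0 addn0 eq_sym.
have srcR s tau : tau \in R -> source tau = s -> s \in supp R.
  by move=> tauR <-; rewrite inE map_f.
(* Follow a path from [s0 G] to [x] and look at the last point where it is still in the support of
   [T]: from there on it uses edges of [R] only. *)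
have near x : x \in supp R ->
    exists2 y, y \in supp T :&: supp R & connect (edge R) y x.
  have Q : forall x, reached (T ++ R) x ->
      x \in supp T \/ exists2 y, y \in supp T :&: supp R & connect (edge R) y x.
    move=> {}x; elim=> [|tau z _ IH tauTR tz].
      by left; rewrite -nsrc_gt0 balT eqxx addn1.
    move: tauTR; rewrite mem_cat => /orP[tauT|tauR].
      by left; rewrite -nsrc_gt0 balT ltn_addr // (leq_trans tz) // ntgt_ge.
    right; have e : edge R (source tau) z by apply/hasP; exists tau; rewrite ?eqxx.
    case: IH => [sT|[y yA c]]; last by exists y => //; apply: connect_trans c (connect1 e).
    by exists (source tau); [rewrite inE sT (srcR _ tau) | apply: connect1].
  move=> xR; case: (Q x (reach x xR)) => // xT.
  by exists x; rewrite ?connect0 // inE xT.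
(* Reachability by at least one edge, so that [r y y] is a genuine cycle. *)
pose r y x := [exists z, edge R y z && connect (edge R) z x].
have rE x y z : connect (edge R) x y -> edge R y z -> r x z.
  case/connectP=> -[_ -> e|w p /= /andP[e1 pp] -> e]; apply/existsP.
    by exists z; rewrite e connect0.
  by exists w; rewrite e1 (connect_trans _ (connect1 e)) //; apply/connectP; exists p.
have rt : transitive r.
  move=> y x z /existsP[u /andP[xu uy]] /existsP[v /andP[yv vz]].
  apply/existsP; exists u; rewrite xu (connect_trans uy) //.
  exact: connect_trans (connect1 yv) vz.
have [a aA] : exists a, a \in supp T :&: supp R.
  case: (R) Rn0 near => // tau R' _ near.
  by have [|y yA _] := near (source tau); [rewrite inE mem_head | exists y].
(* A shared state has an incoming edge in [R] by balance, and [near] leads from a shared state to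
   the source of that edge. *)
have [|y yA /existsP[z /andP[yz zy]]] := transitive_has_loop rt aA.
  move=> y /setIP[_ yR]; have := yR; rewrite -nsrc_gt0 bal => /ntgt_gt0[tau tauR ty].
  have [x xA c] := near _ (srcR _ _ tauR erefl); exists x => //; apply: rE c _.
  by apply/hasP; exists tau; rewrite ?eqxx.
have [P [R' [eR Pn0 fP]]] := cycle_fires Rd bal yz zy.
have [T' fT' eT'] := fires_insert fP fT (proj1 (setIP yA)).
exists T', R'; split=> //.
  rewrite perm_sym (permPl (perm_cat eT' (perm_refl R'))) -catA perm_catCA perm_cat2l.
  by rewrite perm_sym.
by rewrite (perm_size eR) size_cat; case: (P) Pn0 => // ? ?; rewrite ltnS leq_addl.
Qed.

(** A greedy firing sequence leaves a balanced remainder, which splicing shrinks until nothing is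
    left. *)
Lemma euler L : {subset L <= delta G} -> (forall s, nsrc L s = ntgt L s + (s == s0 G)) ->
  (forall s, s \in supp L -> reached L s) ->
  exists2 T, fires G [:: s0 G] T [::] & perm_eq L T.
Proof.
move=> Ld bal reach.
have [//|//|s|T0 [R0 [e0 f0]]] := @greedy S G (size L) [:: s0 G] L.
  by rewrite bal /= addn0 eq_sym.
elim: {R0}(size R0) {-2}R0 (leqnn (size R0)) T0 e0 f0 => [|n IH] R sR T e f.
  by exists T => //; move: e; case: R sR => //; rewrite cats0.
case: (eqVneq R [::]) => [R0|Rn0]; first by exists T => //; rewrite R0 cats0 in e.
have [|//|//|s|s sR'|T' [R' [f' e' s']]] := @splice_cycle T R.
- by move=> tau tauR; apply: Ld; rewrite (perm_mem e) mem_cat tauR orbT.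
- have := bal s; rewrite (nsrc_perm _ e) (ntgt_perm _ e) nsrc_cat ntgt_cat.
  by have := fires_balance s f; rewrite /= addn0 addn0 [_ == s]eq_sym; lia.
- have: reached L s by apply: reach; rewrite (supp_perm e) supp_cat inE sR' orbT.
  elim=> [|tau z _ IH' tauL tz]; first exact: reached_start.
  by apply: reached_step IH' _ tz; rewrite -(perm_mem e).
apply: (IH R' _ T') => //; first by rewrite -ltnS (leq_trans s').
exact: perm_trans e e'.
Qed.

(** Every fired state is a token that was there initially or was produced by an earlier firing. The
    fixed [K] lets the induction pass to the tail of [L]. *)
Lemma fires_reached m L m' K : fires G m L m' -> {subset L <= K} ->
  {in m, forall s, reached K s} -> forall s, s \in supp L -> reached K s.
Proof.
elim: L m => [|tau L IH] m /=; first by move=> _ _ _ s; rewrite inE.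
case=> td [q e f] LK mK s.
have tK : reached K (source tau) by apply: mK; rewrite (perm_mem e) mem_head.
rewrite inE /= inE => /predU1P[-> //|sL].
apply: (IH _ f) => [t tL|t|]; first by apply: LK; rewrite inE tL orbT.
  rewrite mem_cat mem_kids => /orP[tt|tq]; last by apply: mK; rewrite (perm_mem e) inE tq orbT.
  by apply: reached_step tK _ tt; apply: LK; rewrite mem_head.
by rewrite inE.
Qed.

(** * Passing between vectors of counts and sequences of transitions *)

Section Counts.
Variable D : trans S -> nat.

Definition unfold_counts := flatten [seq nseq (D tau) tau | tau <- delta G].

Lemma mem_unfold tau : (tau \in unfold_counts) = (tau \in delta G) && (0 < D tau).
Proof.
apply/flatten_mapP/andP => [[t td]|[td D0]].
  by rewrite mem_nseq => /andP[D0 /eqP->].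
by exists tau => //; rewrite mem_nseq D0 /=.
Qed.

Lemma sum_unfold (F : trans S -> nat) :
  \sum_(tau <- unfold_counts) F tau = \sum_(tau <- delta G) D tau * F tau.
Proof.
rewrite big_flatten big_map; apply: eq_bigr => tau _.
by rewrite big_nseq iter_addn_0 mulnC.
Qed.

Lemma src_of_unfold s : src_of G D s = nsrc unfold_counts s.
Proof.
rewrite /nsrc sum_unfold /src_of big_mkcond; apply: eq_bigr => tau _.
by case: eqP => _; rewrite ?muln1 ?muln0.
Qed.

Lemma tgt_of_unfold s : tgt_of G D s = ntgt unfold_counts s.
Proof. by rewrite /ntgt sum_unfold. Qed.

Lemma out_of_unfold c : out_of G D c = outL unfold_counts c.
Proof. by rewrite /outL sum_unfold ffunE. Qed.

Lemma reached_pathP t : reached unfold_counts t <-> t = s0 G \/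
  exists (tau1 : trans S) (rest : seq (trans S)),
    all (fun tau => (tau \in delta G) && (0 < D tau)) (tau1 :: rest) /\
    source tau1 = s0 G /\
    path (fun tau tau' => 0 < target tau (source tau')) tau1 rest /\
    0 < target (last tau1 rest) t.
Proof.
split.
  elim=> [|tau z _ [] IH]; first by left.
    rewrite mem_unfold => tD tz; right.
    by exists tau, [::]; rewrite /= tD.
  case: IH => tau1 [rest [al [s1 [pa ta]]]]; rewrite mem_unfold => tD tz; right.
  exists tau1, (rcons rest tau); rewrite last_rcons rcons_path pa ta; split=> //.
  by rewrite -rcons_cons all_rcons tD.
case=> [->|[tau1 [rest [al [s1 [pa ta]]]]]]; first exact: reached_start.
have: reached unfold_counts (source tau1) by rewrite s1; apply: reached_start.
elim: rest tau1 al {s1} pa ta => [|tau2 rest IH] tau1 /= /andP[t1 al] pa ta r1.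
  by apply: reached_step r1 _ ta; rewrite mem_unfold.
case/andP: pa => t12 pa; apply: (IH tau2) => //.
by apply: reached_step r1 _ t12; rewrite mem_unfold.
Qed.

End Counts.

Lemma perm_unfold L : {subset L <= delta G} -> perm_eq L (unfold_counts (fun tau => count_mem tau L)).
Proof.
move=> Ld; apply/allP=> tau _ /=; apply/eqP.
have -> : count_mem tau (unfold_counts (fun t : trans S => count_mem t L)) =
    \sum_(t <- unfold_counts (fun t : trans S => count_mem t L)) (t == tau).
  by rewrite -sum1_count big_mkcond.
rewrite sum_unfold; case: (boolP (tau \in delta G)) => td.
  rewrite (bigD1_seq tau) ?delta_uniq //= eqxx muln1 big1 ?addn0 // => t /negPf ->.
  by rewrite muln0.
rewrite big1_seq => [|t /= td']; first by apply/count_memPn/(contra _ td)/Ld.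
by case: eqP => [e|_]; [rewrite -e td' in td | rewrite muln0].
Qed.

Lemma out_langP u : out_lang G u <->
  exists2 L, fires G [:: s0 G] L [::] & forall c, u c = outL L c.
Proof.
split=> [[D [[bal reach] ->]]|[L fL uL]].
  have [|s|s|T fT e] := @euler (unfold_counts D).
  - by move=> tau; rewrite mem_unfold => /andP[].
  - by rewrite -src_of_unfold -tgt_of_unfold.
  - by rewrite -nsrc_gt0 -src_of_unfold => /reach /reached_pathP.
  exists T => // c; rewrite out_of_unfold; exact: perm_big.
have e := perm_unfold (fires_delta fL); set D := fun _ => _ in e.
exists D; split; first split=> [s|t].
- rewrite src_of_unfold tgt_of_unfold -(nsrc_perm _ e) -(ntgt_perm _ e).
  by have := fires_balance s fL; rewrite /= addn0 addn0 [_ == s]eq_sym.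
- rewrite src_of_unfold -(nsrc_perm _ e) nsrc_gt0 => tL; apply/reached_pathP.
  apply: (fires_reached fL _ _ tL) => [tau|s]; first by rewrite (perm_mem e).
  by rewrite inE => /eqP ->; apply: reached_start.
- by apply/ffunP=> c; rewrite uL out_of_unfold; apply: perm_big.
Qed.

End Ordering.

(** * Pumping *)

Section Pumping.
Variables (S : finType) (G : cgrammar S).
Implicit Types (m q r : seq S) (L K P T R : seq (trans S)) (s t x y z : S).

Lemma weight_perm L1 L2 : perm_eq L1 L2 -> weight L1 = weight L2.
Proof. exact: perm_big. Qed.

Lemma weight_cat L1 L2 : weight (L1 ++ L2) = weight L1 + weight L2.
Proof. exact: big_cat. Qed.

(** A sequence from one state to the empty multiset stands for a derivation tree. Here [K] is the
    tree of [L] with the subtree [L'] cut off, leaving the lone leaf [s']. *)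
Definition subtree s L s' L' : Prop :=
  fires G [:: s'] L' [::] /\ exists2 K, perm_eq L (K ++ L') & fires G [:: s] K [:: s'].

Lemma subtree_refl s L : fires G [:: s] L [::] -> subtree s L s L.
Proof. by move=> f; split=> //; exists [::] => //=. Qed.

Lemma subtree_trans s1 L1 s2 L2 s3 L3 :
  subtree s1 L1 s2 L2 -> subtree s2 L2 s3 L3 -> subtree s1 L1 s3 L3.
Proof.
case=> _ [K e f] [f3 [K' e' f']]; split=> //; exists (K ++ K').
  by rewrite (permPl e) -catA perm_cat2l.
exact: fires_cat f f'.
Qed.

Lemma subtree_weight s L s' L' : subtree s L s' L' -> weight L' <= weight L.
Proof. by case=> _ [K /weight_perm -> _]; rewrite weight_cat leq_addl. Qed.

Lemma subtree_supp s L s' L' : subtree s L s' L' -> supp L' \subset supp L.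
Proof. by case=> _ [K /supp_perm -> _]; rewrite supp_cat subsetUr. Qed.

(** The root transition outputs at most one letter and has at most two children, so the heavier
    child carries at least half of the rest. *)
Lemma heavy_child s L : fires G [:: s] L [::] ->
  weight L <= 1 \/
  exists s' L', [/\ subtree s L s' L', size L' < size L & weight L <= 2 * weight L' + 1].
Proof.
case: L => [|tau L] /=; first by move/perm_nilP.
case=> td [q e].
have [/eqP se q0] : source tau == s /\ q = [::].
  have sq := perm_size e; case: q e sq => // e _.
  by have := perm_mem e s; rewrite !inE eqxx eq_sym => <-.
rewrite {q}q0 cats0 in e *.
have wt : weight (tau :: L) = vsize (tout tau) + weight L by apply: big_cons.
have w1 := delta_out td; have := delta_target td; rewrite -size_kids.
have step t L1 K : perm_eq L (K ++ L1) -> fires G (kids tau) K [:: t] ->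
    fires G [:: t] L1 [::] -> subtree s (tau :: L) t L1.
  move=> eL fK f1; split=> //; exists (tau :: K); first by rewrite perm_cons.
  by split=> //; exists [::]; rewrite ?cats0.
case ek: (kids tau) => [|t1 [|t2 [|//]]] _ f.
- left; have : weight L = 0 by case: (L) f => [_|t L' [_ [r /perm_size]]] //; apply: big_nil.
  lia.
- right; exists t1, L; split=> //; last by lia.
  by apply: (step _ _ [::]) => //=; rewrite ek.
- right; have [L1 [L2 [eL f1 f2]]] := @fires_split S G [:: t1] [:: t2] L f.
  have eL' : perm_eq L (L2 ++ L1) by rewrite (permPl eL) perm_catC.
  have sL : size L = size L1 + size L2 by rewrite (perm_size eL) size_cat.
  have wL := weight_perm eL; rewrite weight_cat in wL.
  case: (leqP (weight L2) (weight L1)) => le12.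
    exists t1, L1; split; [|by rewrite /=; lia|by lia].
    apply: (step _ _ L2 eL') => //; rewrite ek.
    apply: fires_perm (fires_frame [:: t1] f2); by rewrite (perm_catC [:: t2] [:: t1]).
  exists t2, L2; split; [|by rewrite /=; lia|by lia].
  apply: (step _ _ L1 eL) => //; rewrite ek.
  exact: fires_frame [:: t2] f1.
Qed.

(** Descend to the heavier child while the weight exceeds [2 * g]; one step from there cannot fall
    below [g]. *)
Lemma heavy_subtree g s L : fires G [:: s] L [::] -> 0 < g <= weight L ->
  exists s' L', subtree s L s' L' /\ g <= weight L' <= 2 * g.
Proof.
elim: {L}(size L).+1 {-2}L (ltnSn (size L)) s => // n IH L sL s f /andP[g0 gL].
case: (leqP (weight L) (2 * g)) => [le2|lt2].
  by exists s, L; rewrite gL le2; split=> //; apply: subtree_refl.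
case: (heavy_child f) => [w1|[s' [L' [sub sL' wL]]]]; first by lia.
have [||s2 [L2 [sub2 ?]]] := IH L' _ s' (proj1 sub).
- exact: leq_trans sL' _.
- by lia.
by exists s2, L2; split=> //; apply: subtree_trans sub2.
Qed.

Lemma lighter_subtree n s L : fires G [:: s] L [::] -> 2 ^ n.+1 <= weight L ->
  exists s' L', [/\ subtree s L s' L', weight L' < weight L & 2 ^ n <= weight L'].
Proof.
rewrite expnS; have n0 : 0 < 2 ^ n by rewrite expn_gt0.
elim: {L}(size L).+1 {-2}L (ltnSn (size L)) s => // k IH L sL s f wn.
case: (heavy_child f) => [w1|[s' [L' [sub sL' wL]]]]; first by lia.
case: (ltnP (weight L') (weight L)) => [lt|ge].
  by exists s', L'; split=> //; lia.
have [||s2 [L2 [sub2 l2 ?]]] := IH L' _ s' (proj1 sub).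
- exact: leq_trans sL' _.
- by lia.
exists s2, L2; split=> //; first exact: subtree_trans sub2.
by apply: leq_trans l2 (subtree_weight sub).
Qed.

(** Pass to a strictly lighter subtree, losing at most one factor of two. Either the root color
    recurs inside it, or that color can be removed from [X]. *)
Lemma repeated_color (C : finType) (color : S -> seq (trans S) -> C) (X : {set C}) s L :
  fires G [:: s] L [::] -> 2 ^ #|X| <= weight L ->
  (forall s' L', subtree s L s' L' -> color s' L' \in X) ->
  exists s1 L1 s2 L2, [/\ subtree s L s1 L1, subtree s1 L1 s2 L2,
    weight L2 < weight L1 & color s1 L1 = color s2 L2].
Proof.
elim: {X}#|X| {-2}X (erefl #|X|) s L => [|n IH] X cX s L f w colX.
  by have := colX _ _ (subtree_refl f); rewrite (cards0_eq cX) inE.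
have cX0 : color s L \in X by apply/colX/subtree_refl.
rewrite (cardsD1 (color s L)) cX0 add1n in cX w.
have [s' [L' [sub lt w']]] := lighter_subtree f w.
have [[s2 [L2 [sub2 eqc]]]|fresh] := classic
    (exists s2 L2, subtree s' L' s2 L2 /\ color s2 L2 = color s L).
  exists s, L, s2, L2; split=> //; first exact: subtree_refl.
    exact: subtree_trans sub2.
  exact: leq_ltn_trans (subtree_weight sub2) lt.
have [||s1 [L1 [s2 [L2 [sub1 ? ? ?]]]]] := IH _ _ s' L' (proj1 sub) w'.
- by case: cX.
- move=> s2 L2 sub2; rewrite !inE (colX _ _ (subtree_trans sub sub2)) andbT.
  by apply/eqP=> eqc; apply: fresh; exists s2, L2.
by exists s1, L1, s2, L2; split=> //; apply: subtree_trans sub1.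
Qed.

(** The number of pairs formed by a root state and a support size. *)
Definition height := #|S| * #|S|.+1.

Definition loop s P := fires G [:: s] P [:: s].

(* A repeated pair (root state, size of the support) on a branch of nested
   subtrees repeats the support itself, so that excising the part in between
   does not lose any state. *)
Lemma pump_out s L : fires G [:: s] L [::] -> 2 ^ height <= weight L ->
  exists t P L', t \in supp L /\ [/\ loop t P, 0 < weight P <= 2 * 2 ^ height,
    fires G [:: s] L' [::], perm_eq L (P ++ L') & supp L' = supp L].
Proof.
move=> f w; have [|s0 [L0 [sub0 w0]]] := @heavy_subtree (2 ^ height) s L f.
  by rewrite expn_gt0.
have [||s1 [L1 [s2 [L2 [sub1 sub2 lt]]]]] :=
  @repeated_color _ (fun t K => (t, inord #|supp K| : 'I_#|S|.+1)) setT s0 L0 (proj1 sub0).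
- by rewrite cardsT card_prod card_ord -/height; case/andP: w0.
- by move=> *; rewrite inE.
case=> es /(congr1 val); rewrite /= !inordK ?ltnS ?max_card // => ec.
have {ec} eS : supp L1 = supp L2.
  by apply/esym/eqP; rewrite eqEcard (subtree_supp sub2) ec leqnn.
rewrite -{s2}es in sub2.
have [f1 [K eK fK]] := subtree_trans sub0 sub1.
have [f2 [P eP fP]] := sub2.
have eL : perm_eq L (P ++ (K ++ L2)).
  by rewrite (permPl eK) perm_sym perm_catCA perm_cat2l perm_sym.
have wP := weight_perm eP; rewrite weight_cat in wP.
have w1 := subtree_weight sub1.
exists s1, P, (K ++ L2); split; last split=> //.
(* [L1] consumes its initial token [s1], so [s1] is in its support. *)
- rewrite (supp_perm eK) supp_cat inE -(nsrc_gt0 L1).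
  have := fires_balance s1 f1; rewrite /= eqxx addn0 addn0 => ->.
  by rewrite addn1 orbT.
- by lia.
- exact: fires_cat fK f2.
- by rewrite (supp_perm eK) !supp_cat eS.
Qed.

End Pumping.

(** * Slopes in the plane *)

(** Totality and transitivity are asked on [P] only, because comparison of slopes is not transitive
    through the zero vector. *)
Lemma exists_greatest (T : eqType) (r : rel T) (P : T -> Prop) (l : seq T) :
  (forall x y, P x -> P y -> r x y || r y x) ->
  (forall x y z, P x -> P y -> P z -> r x y -> r y z -> r x z) ->
  (exists2 x, x \in l & P x) ->
  exists2 x, P x & forall y, y \in l -> P y -> r y x.
Proof.
move=> tot tr; elim: l => [|a l IH] [x //].
have rr z : P z -> r z z by move=> Pz; have := tot z z Pz Pz; rewrite orbb.
have [ex|nex] := classic (exists2 z, z \in l & P z).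
  move=> _ _; have [b Pb bmax] := IH ex.
  have [Pa|nPa] := classic (P a); last first.
    by exists b => // y; rewrite inE => /predU1P[->|/bmax].
  case/orP: (tot a b Pa Pb) => h.
    by exists b => // y; rewrite inE => /predU1P[->|/bmax].
  exists a => // y; rewrite inE => /predU1P[->|yl] Py; first exact: rr.
  by apply: tr h => //; apply: bmax.
rewrite inE => /predU1P[-> Pa|xl Px]; last by case: nex; exists x.
exists a => // y; rewrite inE => /predU1P[->|yl] Py; first exact: rr.
by case: nex; exists y.
Qed.

Lemma vsizeE (v : vec) : vsize v = v true + v false.
Proof. by rewrite /vsize big_bool. Qed.

(** Cross-multiplied comparison of the ratios of the [false] to the [true] coordinate, so vertical
    vectors have infinite slope. The zero vector is comparable both ways with every vector. *)
Definition slope_le (u v : vec) := u false * v true <= v false * u true.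

Lemma slope_le_total u v : slope_le u v || slope_le v u.
Proof. by rewrite /slope_le; nia. Qed.

Lemma slope_le_trans u v w :
  0 < vsize v -> slope_le u v -> slope_le v w -> slope_le u w.
Proof.
rewrite vsizeE /slope_le => v0 uv vw.
case: (posnP (v true)) => [vt|vt]; last first.
  rewrite -(leq_pmul2r vt); apply: (@leq_trans (v false * u true * w true)).
    by rewrite mulnAC leq_mul2r uv orbT.
  by rewrite mulnAC [leqRHS]mulnAC leq_mul2r vw orbT.
move: v0 vw; rewrite vt muln0 leqn0 muln_eq0 => v0 /orP[/eqP h|/eqP->]; first by rewrite h in v0.
by rewrite muln0.
Qed.

(* Cramer's rule: q is the determinant of v1 and v2, or the size of v1 when they
   are parallel. *)
Lemma cone_multiple (v1 v2 : vec) B :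
  0 < vsize v1 <= B -> 0 < vsize v2 <= B -> slope_le v2 v1 ->
  exists2 q, 0 < q <= B ^ 2 & forall u, slope_le u v1 -> slope_le v2 u ->
    exists a b, forall c, q * u c = a * v1 c + b * v2 c.
Proof.
move=> /andP[p1 s1] /andP[p2 s2] v21.
have [v12|nv12] := boolP (slope_le v1 v2).
  exists (vsize v1) => [|u uv1 v2u].
    by rewrite p1 (leq_trans s1) // expnS expn1 leq_pmulr //; lia.
  have v1u := slope_le_trans p2 v12 v2u.
  have E : u false * v1 true = v1 false * u true.
    by apply/eqP; rewrite eqn_leq; apply/andP.
  (* All vectors of the cone are parallel to [v1], hence [vsize v1 * u = vsize u * v1]. *)
  exists (vsize u), 0 => c; rewrite !vsizeE.
  by case: c; rewrite /= !mulnDl mul0n addn0 ?E; lia.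
exists (v1 false * v2 true - v2 false * v1 true) => [|u].
  move: nv12 s1 s2; rewrite /slope_le -ltnNge !vsizeE => lt s1 s2.
  rewrite subn_gt0 lt /= (leq_trans (leq_subr _ _)) // expnS expn1 leq_mul //; lia.
move: v21; rewrite /slope_le => v21 uv1 v2u.
(* The other two determinants in Cramer's rule; the slope hypotheses make these natural subtractions
   exact. *)
exists (u false * v2 true - v2 false * u true), (v1 false * u true - u false * v1 true).
have := subnK v21; have := subnK uv1; have := subnK v2u.
move: (_ - _) (_ - _) (_ - _) => p b q ep eb eq c.
have := congr1 (muln^~ (u c)) eq; have := congr1 (muln^~ (v1 c)) ep.
have := congr1 (muln^~ (v2 c)) eb; rewrite !mulnDl.
by case: c; lia.
Qed.

(** Group [l] by the value of [F]. In each group, blocks of [q] elements are traded for copies of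
    [v1] and [v2], and fewer than [q] elements remain. *)
Lemma bounded_remainder (T : eqType) (F : T -> vec) (v1 v2 : vec) q (U : seq vec) (l : seq T) :
  0 < q -> (forall x, x \in l -> F x \in U) ->
  (forall x, x \in l -> exists a b, forall c, q * F x c = a * v1 c + b * v2 c) ->
  exists l' n1 n2, [/\ {subset l' <= l}, size l' <= size U * q &
    forall c, \sum_(x <- l) F x c = \sum_(x <- l') F x c + (n1 * v1 c + n2 * v2 c)].
Proof.
move=> q0; elim: U l => [|v U IH] l lU comb.
  case: l lU comb => [|x l] lU _; last by have := lU x (mem_head _ _).
  by exists [::], 0, 0; split=> // c; rewrite big_nil; lia.
have el := permEl (perm_filterC (fun x => F x == v) l).
set lv := filter _ l in el; set lr := filter _ l in el.
have [||l' [n1 [n2 [sub sz sum]]]] := IH lr.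
- move=> x; rewrite mem_filter /= => /andP[nx /lU]; by rewrite inE (negPf nx).
- by move=> x; rewrite mem_filter => /andP[_ /comb].
have lvE k c : \sum_(x <- take k lv) F x c = size (take k lv) * v c.
  rewrite -sum1_size big_distrl /= big_seq [RHS]big_seq; apply: eq_bigr => x /mem_take.
  by rewrite mem_filter mul1n => /andP[/eqP ->].
have [a [b ab]] : exists a b, forall c, size lv %/ q * q * v c = a * v1 c + b * v2 c.
  case E: lv => [|x lv']; first by exists 0, 0 => c; rewrite div0n.
  have : x \in lv by rewrite E mem_head.
  rewrite mem_filter => /andP[/eqP Fx /comb[a [b ab]]]; rewrite -E.
  exists (size lv %/ q * a), (size lv %/ q * b) => c.
  by rewrite -mulnA -Fx ab mulnDr !mulnA.
exists (take (size lv %% q) lv ++ l'), (a + n1), (b + n2); split.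
- move=> x; rewrite mem_cat => /orP[/mem_take|/sub]; by rewrite mem_filter => /andP[].
- rewrite size_cat mulSn leq_add // size_take_min.
  exact: leq_trans (geq_minl _ _) (ltnW (ltn_pmod _ q0)).
- move=> c; rewrite -(perm_big _ el) !big_cat /= sum lvE -{1}(take_size lv) lvE take_size.
  rewrite size_takel ?leq_mod // {1}(divn_eq (size lv) q) !mulnDl ab; lia.
Qed.

(** * Frames indexed by pairs of states *)

Section Frames.
Variables (S : finType) (G : cgrammar S).
Implicit Types (L P : seq (trans S)) (Ps : seq (seq (trans S))) (s t : S).

Local Notation B := (2 * 2 ^ height S).

Definition small_loop s P : Prop := loop G s P /\ 0 < weight P <= B.

Lemma insert_loops s Ps L : fires G [:: s] L [::] ->
  (forall P, P \in Ps -> exists2 t, t \in supp L & loop G t P) ->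
  exists2 L', fires G [:: s] L' [::] & perm_eq L' (flatten Ps ++ L).
Proof.
move=> f; elim: Ps => [|P Ps IH] PsP; first by exists L.
have [Q Qin|L1 f1 e1] := IH; first by apply: PsP; rewrite inE Qin orbT.
have [t tL tP] := PsP P (mem_head _ _).
have [|L2 f2 e2] := fires_insert tP f1 (s := t).
  by rewrite (supp_perm e1) supp_cat inE tL orbT.
exists L2 => //; rewrite (permPl e2) /= -catA perm_cat2l; exact: e1.
Qed.

(** Pump out repeatedly. The support never changes, so each removed loop is based at a state of the
    original support. *)
Lemma extract_loops s L : fires G [:: s] L [::] ->
  exists L0 Ps, [/\ fires G [:: s] L0 [::], weight L0 < 2 ^ height S, supp L0 = supp L,
    perm_eq L (flatten Ps ++ L0) &
    forall P, P \in Ps -> exists2 t, t \in supp L & small_loop t P].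
Proof.
elim: {L}(weight L).+1 {-2}L (ltnSn (weight L)) => // n IH L wL f.
case: (ltnP (weight L) (2 ^ height S)) => [lt|ge]; first by exists L, [::].
have [t [P [L1 [tL [lP wP f1 eL eS]]]]] := pump_out f ge.
have wE := weight_perm eL; rewrite weight_cat in wE.
have [|L0 [Ps [f0 w0 S0 e0 PsP]]] := IH L1 _ f1; first by lia.
exists L0, (P :: Ps); split=> //; first by rewrite S0.
  by rewrite (permPl eL) /= -catA perm_cat2l.
move=> Q; rewrite inE => /predU1P[->|/PsP]; first by exists t.
by rewrite eS.
Qed.

Definition outv L : vec := [ffun c => outL L c].

Lemma vsize_outv L : vsize (outv L) = weight L.
Proof. by rewrite weightE vsizeE !ffunE. Qed.

Lemma outL_perm L1 L2 c : perm_eq L1 L2 -> outL L1 c = outL L2 c.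
Proof. exact: perm_big. Qed.

Lemma outL_cat L1 L2 c : outL (L1 ++ L2) c = outL L1 c + outL L2 c.
Proof. exact: big_cat. Qed.

Lemma outL_flatten Ps c : outL (flatten Ps) c = \sum_(P <- Ps) outv P c.
Proof. by rewrite /outL big_flatten /=; apply: eq_bigr => P _; rewrite ffunE. Qed.

Lemma start_supp L : fires G [:: s0 G] L [::] -> s0 G \in supp L.
Proof.
by move=> f; rewrite -nsrc_gt0; have := fires_balance (s0 G) f; rewrite /= eqxx; lia.
Qed.

Definition box : seq vec :=
  [seq [ffun c => if c then val p.1 else val p.2] | p <- enum {: 'I_B.+1 * 'I_B.+1}].

Lemma size_box : size box = B.+1 ^ 2.
Proof. by rewrite size_map -cardE card_prod card_ord expnS expn1. Qed.

Lemma mem_box (v : vec) : vsize v <= B -> v \in box.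
Proof.
rewrite vsizeE => vB; have v1 : v true < B.+1 by lia.
have v2 : v false < B.+1 by lia.
apply/mapP; exists (Ordinal v1, Ordinal v2); first by rewrite mem_enum.
by apply/ffunP=> -[]; rewrite ffunE.
Qed.

(** Stated for a general [r] so as to serve for both greatest and least slope. A state without small
    loops gets the zero vector, the output of the empty loop, so [f s] is the output of a loop in
    every case. *)
Lemma best_loops (r : rel vec) : total r ->
  (forall u v w, 0 < vsize v -> r u v -> r v w -> r u w) ->
  exists f : S -> vec, forall s,
    [/\ exists2 P, loop G s P & outv P = f s, vsize (f s) <= B &
      forall P, small_loop s P -> 0 < vsize (f s) /\ r (outv P) (f s)].
Proof.
move=> tot tr; apply: (@fin_all_exists S (fun _ => vec) (fun s v =>
  [/\ exists2 P, loop G s P & outv P = v, vsize v <= B &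
      forall P, small_loop s P -> 0 < vsize v /\ r (outv P) v])) => s.
have [[P0 sP0]|none] := classic (exists P, small_loop s P); last first.
  exists (outv [::]); split; first by exists [::] => //; apply: perm_refl.
    by rewrite vsize_outv /weight big_nil.
  by move=> P sP; case: none; exists P.
have box_loop P : small_loop s P -> outv P \in box.
  by case=> _ /andP[_ wP]; apply: mem_box; rewrite vsize_outv.
have [|||v [P [lP wP] <-] vmax] :=
    @exists_greatest _ r (fun v => exists2 P, small_loop s P & outv P = v) box.
- by move=> x y _ _; apply: tot.
- move=> x y z _ [P [_ /andP[wP _]] <-] _; apply: tr; by rewrite vsize_outv.
- by exists (outv P0); [apply: box_loop | exists P0].
case/andP: (wP) => w0 wB.
exists (outv P); split; [by exists P | by rewrite vsize_outv | move=> Q sQ].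
by rewrite vsize_outv; split=> //; apply: vmax; [apply: box_loop | exists Q].
Qed.

Lemma best_state (r : rel vec) (f : S -> vec) L Ps : total r ->
  (forall u v w, 0 < vsize v -> r u v -> r v w -> r u w) ->
  (forall s P, small_loop s P -> 0 < vsize (f s) /\ r (outv P) (f s)) ->
  Ps != [::] -> (forall P, P \in Ps -> exists2 t, t \in supp L & small_loop t P) ->
  exists2 s, s \in supp L & 0 < vsize (f s) /\
    forall t P, t \in supp L -> small_loop t P -> r (outv P) (f s).
Proof.
move=> tot tr best Psn0 PsP.
have [|||s /andP[sL fs] smax] := @exists_greatest _ (fun s t => r (f s) (f t))
    (fun s => (s \in supp L) && (0 < vsize (f s))) (enum S).
- by move=> x y _ _; apply: tot.
- by move=> x y z _ /andP[_ ?] _; apply: tr.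
- case: Ps Psn0 PsP => // P Ps _ /(_ P (mem_head _ _))[t tL /best[ft _]].
  by exists t; rewrite ?mem_enum ?tL.
exists s => //; split=> // t P tL /best[ft rP].
by apply: (tr _ _ _ ft rP); apply: smax; rewrite ?mem_enum ?tL.
Qed.

(** The small core, plus at most [B ^ 2] kept loops for each vector of [box], each loop of weight at
    most [B]. *)
Definition offset_bound := B + B.+1 ^ 2 * B ^ 2 * B.

Lemma out_lang_frames : exists Z : 'I_#|{: S * S}| -> vec -> Prop,
  (forall i, is_frame offset_bound B (Z i)) /\
  (forall u, out_lang G u <-> exists i, Z i u).
Proof.
have slope_ge_total : total (fun u v => slope_le v u).
  by move=> u v; apply: slope_le_total.
have slope_ge_trans u v w : 0 < vsize v -> slope_le v u -> slope_le w v -> slope_le w u.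
  by move=> v0 vu wv; apply: slope_le_trans v0 wv vu.
have [f fP] := best_loops slope_le_total slope_le_trans.
have [g gP] := best_loops slope_ge_total slope_ge_trans.
(* Offsets come from runs visiting both [s] and [t], so that any number of loops with outputs [f s]
   and [g t] can be inserted. *)
pose W s t (w : vec) := (forall c, w c <= offset_bound) /\
  exists2 L, fires G [:: s0 G] L [::] & [/\ s \in supp L, t \in supp L & w = outv L].
pose M s t (y x : bool) := if x then f s y else g t y.
pose Z s t u := exists w v, W s t w /\ u = vadd w (mvmul (M s t) v).
have vle (v : vec) c : v c <= vsize v by rewrite vsizeE; case: c; lia.
exists (fun i => Z (enum_val i).1 (enum_val i).2); split=> [i|u].
  exists (W (enum_val i).1 (enum_val i).2), (M (enum_val i).1 (enum_val i).2); split.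
    by move=> w [].
  split=> // y x; rewrite /M; case: x.
    by have [_ ? _] := fP (enum_val i).1; apply: leq_trans (vle _ _) _.
  by have [_ ? _] := gP (enum_val i).2; apply: leq_trans (vle _ _) _.
have -> : (exists i : 'I_#|{: S * S}|, Z (enum_val i).1 (enum_val i).2 u) <->
    exists s t, Z s t u.
  split=> [[i Zi]|[s [t Zst]]]; first by exists (enum_val i).1, (enum_val i).2.
  by exists (enum_rank (s, t)); rewrite enum_rankK.
rewrite out_langP; split=> [[L fL uL]|[s [t [w [v [[wb [L fL [sL tL ->]]] ->]]]]]]; last first.
  have [[P lP eP] _ _] := fP s; have [[Q lQ eQ] _ _] := gP t.
  have [|L' fL' eL'] := @insert_loops _ (nseq (v true) P ++ nseq (v false) Q) L fL.
    by move=> X; rewrite mem_cat !mem_nseq => /orP[] /andP[_ /eqP->]; [exists s|exists t].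
  exists L' => // c; rewrite !ffunE big_bool (outL_perm _ eL') outL_cat outL_flatten.
  by rewrite big_cat /= !big_nseq !iter_addn_0 eP eQ /M; lia.
have [L0 [Ps [f0 w0 S0 eL PsP]]] := extract_loops fL.
have uE c : u c = outL L0 c + \sum_(P <- Ps) outv P c.
  by rewrite uL (outL_perm _ eL) outL_cat outL_flatten addnC.
have B0 : 2 ^ height S <= offset_bound.
  by rewrite (leq_trans _ (leq_addr _ _)) // leq_pmull.
(* Without removed loops the core itself is the offset, with zero coefficients and the pair of
   states [(s0 G, s0 G)]. *)
case: (eqVneq Ps [::]) => [Ps0|Psn0].
  exists (s0 G), (s0 G), (outv L0), [ffun=> 0]; split; last first.
    apply/ffunP=> c; rewrite !ffunE uE Ps0 big_nil big1 // => x _.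
    by rewrite ffunE.
  split=> [c|]; last by exists L0; rewrite ?start_supp.
  by rewrite (leq_trans (vle _ _)) // vsize_outv (leq_trans (ltnW w0)).
have [|s sL [fs0 smax]] := best_state slope_le_total slope_le_trans _ Psn0 PsP (f := f).
  by move=> s P sP; have [_ _] := fP s; apply.
have [|t tL [gt0 tmin]] := best_state slope_ge_total slope_ge_trans _ Psn0 PsP (f := g).
  by move=> t P sP; have [_ _] := gP t; apply.
have [_ fsB _] := fP s; have [_ gtB _] := gP t.
have PsB P : P \in Ps -> 0 < vsize (outv P) <= B.
  by case/PsP=> x _ [_]; rewrite vsize_outv.
have Ps_between P : P \in Ps -> slope_le (outv P) (f s) /\ slope_le (g t) (outv P).
  by case/PsP=> x xL sP; split; [apply: smax sP | apply: tmin sP].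
have gf : slope_le (g t) (f s).
  case: (Ps) Psn0 PsB Ps_between => // P Ps' _ PB Pb.
  have [] := Pb P (mem_head _ _); have /andP[P0 _] := PB P (mem_head _ _).
  by move=> h1 h2; apply: slope_le_trans P0 h2 h1.
have [||q /andP[q0 qB] comb] := cone_multiple _ _ gf (B := B).
- by rewrite fs0.
- by rewrite gt0.
have [||Ps' [n1 [n2 [sub sz sum]]]] :=
    @bounded_remainder _ outv (f s) (g t) q box Ps q0.
- by move=> P /PsB/andP[_]; apply: mem_box.
- by move=> P /Ps_between[]; apply: comb.
(* The kept loops go back into the core, whose support is still that of [L]; hence [s] and [t] are
   visited and the resulting output is an offset in [W s t]. *)
have [|L' fL' eL'] := @insert_loops _ Ps' L0 f0.
  by move=> P /sub/PsP[x xL [lP _]]; exists x; rewrite ?S0.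
have L'S : {subset supp L <= supp L'}.
  by move=> x xL; rewrite (supp_perm eL') supp_cat S0 inE xL orbT.
have outL' c : outL L' c = outL L0 c + \sum_(P <- Ps') outv P c.
  by rewrite (outL_perm _ eL') outL_cat outL_flatten addnC.
exists s, t, (outv L'), [ffun c => if c then n1 else n2]; split; last first.
  by apply/ffunP=> c; rewrite !ffunE big_bool !ffunE uE sum outL' addnA.
split=> [c|]; last by exists L'; rewrite ?L'S.
rewrite ffunE outL' leq_add //.
  have := vle (outv L0) c; rewrite vsize_outv ffunE => /leq_trans; apply.
  by rewrite (leq_trans (ltnW w0)) // leq_pmull.
apply: (@leq_trans (\sum_(P <- Ps') B)).
  rewrite big_seq [leqRHS]big_seq; apply: leq_sum => P /sub/PsB/andP[_ PB].
  exact: leq_trans (vle _ _) PB.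
rewrite big_const_seq count_predT iter_addn_0 mulnC leq_mul2r; apply/orP; right.
by rewrite (leq_trans sz) // size_box leq_mul2l qB orbT.
Qed.

End Frames.

(** * Numerical bounds *)

Lemma offset_bound_exp (S : finType) : 0 < #|S| ->
  offset_bound S <= 2 ^ (18 * #|S| ^ 2).
Proof.
move=> S0; rewrite /offset_bound; set b := 2 * _.
have b1 : 0 < b by rewrite muln_gt0 expn_gt0.
(* The sum is at most [b ^ 5 + 4 * b ^ 5]. With [n = #|S|], the exponent becomes
   [3 + 5 * (n * (n + 1) + 1)], at most [18 * n ^ 2] for positive [n]. *)
apply: (@leq_trans (2 ^ 3 * b ^ 5)).
  have b5 : b <= b ^ 5 by rewrite -{1}[b]expn1 leq_pexp2l.
  have b2 : b.+1 ^ 2 <= 2 ^ 2 * b ^ 2 by rewrite -expnMn leq_exp2r //; lia.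
  have : b.+1 ^ 2 * b ^ 2 * b <= 4 * b ^ 5.
    by rewrite -mulnA -expnSr (@expnD b 2 3) mulnA leq_mul2r b2 orbT.
  by move: b5; move: (b ^ 5) (b.+1 ^ 2 * b ^ 2 * b) => x y; lia.
rewrite /b -expnS -expnM -expnD leq_pexp2l // /height; nia.
Qed.

Theorem theorem4 :
  exists C : nat,
    forall (S : finType) (G : cgrammar S),
      exists (k A B : nat) (Z : 'I_k -> vec -> Prop),
        k <= C * #|S| ^ C /\
        A <= C * 2 ^ (#|S| ^ C) /\
        B <= C * 2 ^ (#|S| ^ C) /\
        (forall i, is_frame A B (Z i)) /\
        (forall u, out_lang G u <-> exists i, Z i u).
Proof.
(* The factor [2 ^ 18] settles a single state. For [n >= 2] states the exponent 7 suffices, since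
   [18 * n ^ 2 <= 2 ^ 5 * n ^ 2 <= n ^ 7]. *)
have [C [C1 C2]] : exists C, 2 ^ 18 <= C /\ 7 <= C.
  by exists (2 ^ 18 + 7); rewrite leq_addl leq_addr.
exists C => S G; have [Z [frZ outZ]] := out_lang_frames G.
have S0 : 0 < #|S| by apply/card_gt0P; exists (s0 G).
have C0 : 0 < C by apply: leq_trans C2.
have Abound : offset_bound S <= C * 2 ^ (#|S| ^ C).
  apply: leq_trans (offset_bound_exp S0) _.
  apply: (@leq_trans (2 ^ 18 * 2 ^ (#|S| ^ C))); last by rewrite leq_mul2r C1 orbT.
  rewrite -expnD leq_pexp2l //; case: (leqP 2 #|S|) => [S2|S1]; last first.
    by have -> : #|S| = 1 by [lia]; rewrite exp1n.
  apply: (@leq_trans (#|S| ^ 7)); last by rewrite (leq_trans _ (leq_addl _ _)) // leq_pexp2l.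
  by rewrite (@expnD _ 5 2) leq_mul2r (@leq_trans (2 ^ 5)) ?orbT // leq_exp2r.
exists #|{: S * S}|, (offset_bound S), (2 * 2 ^ height S), Z.
split; last split=> //; last split=> //.
  rewrite card_prod -[#|S| * _]/(#|S| ^ 2) (leq_trans _ (leq_pmull _ C0)) // leq_pexp2l //.
  exact: leq_trans C2.
exact: leq_trans (leq_addr _ _) Abound.
Qed.
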